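(* Let $(\mathcal{T},\Delta)$ be the compact quantum semigroup given by the Toeplitz algebra $\mathcal{T}$ generated by the unilateral shift $T$, with comultiplication determined by $\Delta(T)=T\otimes T$. Let $h$ be its Haar functional, determined by $h(I)=1$ and $h(T^nT^{*m})=0$ for all non-negative integers $n,m$ not both zero, and let $(H_h,\pi_h)$ be the GNS representation of $\mathcal{T}$ associated with $h$. Then there does not exist a multiplicative unitary $u\in B(H_h\otimes H_h)$ such that $$(\pi_h\otimes\pi_h)\Delta(a)=u(\pi_h(a)\otimes I)u^*\quad\text{for all } a\in\mathcal{T}.$$
   Context: The Toeplitz algebra $\mathcal{T}$ is the $C^*$-algebra generated by the isometric unilateral shift $T$ and $T^*$ on a Hilbert space with orthonormal basis $\{e_n\}_{n=0}^\infty$ (so $Te_n=e_{n+1}$). Linear combinations of the operators $T_{n,m}=T^nT^{*m}$, $n,m\ge 0$, are dense in $\mathcal{T}$. It is known that there is a unital $*$-homomorphism $\Delta\colon\mathcal{T}\to\mathcal{T}\otimes\mathcal{T}$ (minimal tensor product) with $\Delta(T)=T\otimes T$, that it satisfies $(\Delta\otimes \mathrm{id})\Delta=(\mathrm{id}\otimes\Delta)\Delta$, and that the formulas $h(I)=1$ and $h(T^nT^{*m})=0$ for all non-negative integers $n,m$ not both zero define a state $h$ on $\mathcal{T}$ which is the Haar functional of $(\mathcal{T},\Delta)$, i.e. $(h\otimes \mathrm{id})\Delta(a)=h(a)I=(\mathrm{id}\otimes h)\Delta(a)$ for all $a\in\mathcal{T}$. For a Hilbert space $H$, let $\sigma\colon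 H\otimes H\to H\otimes H$ be the flip $\sigma(x\otimes y)=y\otimes x$. For $a\in B(H\otimes H)$ put $a_{12}=a\otimes I$, $a_{23}=I\otimes a$, $a_{13}=\sigma_{12}a_{23}\sigma_{12}=\sigma_{23}a_{12}\sigma_{23}$, as operators on $H\otimes H\otimes H$. A multiplicative unitary is a unitary $u\in B(H\otimes H)$ satisfying the pentagon equation $u_{12}u_{13}u_{23}=u_{23}u_{12}$. *)

(* Defs.v *)
From HB Require Import structures.
From mathcomp Require Import all_boot all_order all_algebra sesquilinear complex.
From mathcomp Require Import ring.
From mathcomp Require Import all_classical all_reals all_analysis.

Set Implicit Arguments.
Unset Strict Implicit.
Unset Printing Implicit Defensive.

Import Order.TTheory GRing.Theory Num.Theory.
Import numFieldNormedType.Exports.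

Local Open Scope classical_set_scope.
Local Open Scope ring_scope.

(* The norm takes its values in R[i]; inner is linear in its first argument and
   conjugate-linear in the second. *)
HB.mixin Record NormedModule_isHilbert (R : realType) H
    of CompleteNormedModule R[i] H := {
  inner : {dot H for @Num.conj R[i]} ;
  innerxx : forall x : H, inner x x = `|x| ^+ 2 }.

#[short(type="hilbertType")]
HB.structure Definition Hilbert (R : realType) :=
  {H of CompleteNormedModule R[i] H & NormedModule_isHilbert R H}.

Notation "<[ x , y ]>" := (inner x y) (at level 0, format "<[ x ,  y ]>").

Section BoundedOp.
Context {R : realType} (H : hilbertType R).

Definition bounded_linear : {pred H -> H} :=
  mem [set f : H -> H | linear f /\ continuous f].

Record boundedOp := BoundedOp { opfun :> H -> H ; _ : opfun \in bounded_linear }.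

HB.instance Definition _ := [isSub for opfun].
HB.instance Definition _ := [Choice of boundedOp by <:].

Lemma bounded_linear_submod : submod_closed bounded_linear.
Proof.
split; first by rewrite inE; split=> [k x y|x]; [rewrite /= scaler0 addr0|exact: cst_continuous].
move=> k f g; rewrite !inE => -[lf cf] [lg cg]; split => [c x y|x].
  rewrite !fctE lf lg !scalerDr !scalerA (mulrC c) -!addrA; congr (_ + _).
  by rewrite addrCA.
apply: continuousD; last exact: cg.
by apply: continuousZ; [exact: cst_continuous|exact: cf].
Qed.

HB.instance Definition _ := GRing.isSubmodClosed.Build R[i] (H -> H)
  bounded_linear bounded_linear_submod.
HB.instance Definition _ := [SubChoice_isSubLmodule of boundedOp by <:].

Lemma boundedOpP (a : boundedOp) : linear a /\ continuous a.
Proof. by case: a => f /=; rewrite inE. Qed.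

Lemma boundedOp_linear (a : boundedOp) : linear a.
Proof. exact: (boundedOpP a).1. Qed.

HB.instance Definition _ (a : boundedOp) :=
  GRing.isLinear.Build R[i] H H *:%R a (boundedOp_linear a).

Lemma boundedOp_ext (a b : boundedOp) : a =1 b -> a = b.
Proof. by move=> ab; apply: val_inj; apply/funext. Qed.

Lemma id_bounded_linear : (@id H) \in bounded_linear.
Proof. by rewrite inE; split => // x. Qed.

Lemma comp_bounded_linear (a b : boundedOp) : a \o b \in bounded_linear.
Proof.
rewrite inE; split => [k x y|x] /=; first by rewrite !linearP.
by apply: continuous_comp; [exact: (boundedOpP b).2|exact: (boundedOpP a).2].
Qed.

Definition op1 := BoundedOp id_bounded_linear.
Definition opmul a b := BoundedOp (comp_bounded_linear a b).

Fact opmulA : associative opmul.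
Proof. by move=> a b c; apply: boundedOp_ext. Qed.
Fact opmul1 : left_id op1 opmul.
Proof. by move=> a; apply: boundedOp_ext. Qed.
Fact op1mul : right_id op1 opmul.
Proof. by move=> a; apply: boundedOp_ext. Qed.
Fact opmulDl : left_distributive opmul +%R.
Proof. by move=> a b c; apply: boundedOp_ext. Qed.
Fact opmulDr : right_distributive opmul +%R.
Proof. by move=> a b c; apply: boundedOp_ext => x; rewrite /= raddfD. Qed.

HB.instance Definition _ := GRing.Zmodule_isPzRing.Build boundedOp
  opmulA opmul1 op1mul opmulDl opmulDr.

Lemma op1E x : (1 : boundedOp) x = x. Proof. by []. Qed.
Lemma opME (a b : boundedOp) x : (a * b) x = a (b x). Proof. by []. Qed.
Lemma opDE (a b : boundedOp) x : (a + b) x = a x + b x. Proof. by []. Qed.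
Lemma opNE (a : boundedOp) x : (- a) x = - a x. Proof. by []. Qed.
Lemma opZE k (a : boundedOp) x : (k *: a) x = k *: a x. Proof. by []. Qed.
Lemma op0E x : (0 : boundedOp) x = 0. Proof. by []. Qed.

Lemma boundedOp_bounded (a : boundedOp) :
  exists2 M : R[i], 0 < M & forall x, `|a x| <= M * `|x|.
Proof.
have /linear_bounded_continuous/linear_boundedP : continuous a.
  exact: (boundedOpP a).2.
by move=> /pinfty_ex_gt0[M M0 aM]; exists M.
Qed.

Lemma bounded_boundedOp (f : H -> H) (M : R[i]) : 0 <= M -> linear f ->
  (forall x, `|f x| <= M * `|x|) -> exists a : boundedOp, a =1 f.
Proof.
move=> M0 lf fM.
pose fL := GRing.isLinear.Build R[i] H H *:%R f lf.
pose g : {linear H -> H} := HB.pack f fL.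
suff fbl : f \in bounded_linear by exists (BoundedOp fbl).
rewrite inE; split=> //; apply: (@bounded_linear_continuous _ _ _ g).
apply/linear_boundedP.
near=> r => x; rewrite (le_trans (fM x))// ler_wpM2r//.
by near: r; apply: nbhs_pinfty_ge; rewrite ger0_real.
Unshelve. all: by end_near. Qed.

End BoundedOp.

Section Complete.
Context {R : realType} (H : hilbertType R).

Lemma complete_eps (P : R[i] -> set H) :
  (forall e, 0 < e -> P e !=set0) ->
  (forall e d x y, 0 < e -> 0 < d -> P e x -> P d y -> `|x - y| <= e + d) ->
  exists z : H, forall e x, 0 < e -> P e x -> `|x - z| <= e.
Proof.
move=> P0 PP.
have eps0 (n : nat) : 0 < (n.+1%:R^-1 : R)%:C%C by rewrite ltcR invr_gt0.
pose u n := sval (cid (P0 _ (eps0 n))).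
have Pu n : P (n.+1%:R^-1 : R)%:C%C (u n) by rewrite /u; case: cid.
have small (e : R[i]) : 0 < e -> exists n : nat, (n.+1%:R^-1 : R)%:C%C <= e.
  case: e => a b; rewrite ltcE/= => /andP[/eqP -> a0].
  exists (Num.bound a^-1); rewrite lecR -[leRHS]invrK lef_pV2 ?posrE ?invr_gt0//.
  have h : a^-1 < (Num.bound a^-1)%:R by apply: archi_boundP; rewrite invr_ge0 ltW.
  by rewrite (le_trans (ltW h))// ler_nat.
have mono (m n : nat) : (n <= m)%N -> (m.+1%:R^-1 : R)%:C%C <= (n.+1%:R^-1 : R)%:C%C.
  by move=> nm; rewrite lecR lef_pV2 ?posrE// ler_nat ltnS.
have /cauchy_cvgP/cvg_ex[z uz] : cauchy (u @ \oo).
  apply/cauchy_exP => e e0 /=.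
  have [n ne] := small _ (divr_gt0 e0 (ltr0Sn R[i] 3)).
  exists (u n); exists n => // m /= nm; rewrite -ball_normE /ball_/=.
  apply: (le_lt_trans (PP _ _ _ _ (eps0 n) (eps0 m) (Pu n) (Pu m))).
  apply: (@le_lt_trans _ _ (e / 4 + e / 4)).
    by apply: lerD => //; exact: le_trans (mono _ _ nm) ne.
  have -> : e / 4 + e / 4 = e / 2 by field.
  by rewrite [ltRHS]splitr ltrDl divr_gt0.
exists z => e x e0 Px; apply/ler_addgt0Pr => d d0.
have d20 : 0 < d / 2 by rewrite divr_gt0.
have [n nd] := small _ d20.
move/cvgrPdist_le : uz => /(_ _ d20)[m _ mz].
pose k := maxn m n.
have := mz k; rewrite /= leq_maxl => /(_ isT) zk.
rewrite -(subrK (u k) x) -addrA (le_trans (ler_normD _ _))//.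
rewrite (splitr d) addrA; apply: lerD; last by rewrite distrC.
apply: (le_trans (PP _ _ _ _ e0 (eps0 k) Px (Pu k))).
by rewrite lerD2l (le_trans _ nd)// mono// leq_maxr.
Qed.

End Complete.

Section Inner.
Context {R : realType} (H : hilbertType R).
Implicit Types x y z : H.

Lemma innerC x y : <[x, y]> = (<[y, x]>)^*.
Proof. by have := hermC (@inner R H) x y; rewrite expr0 mul1r. Qed.

Lemma innerDl x y z : <[x + y, z]> = <[x, z]> + <[y, z]>.
Proof. exact: linearDl. Qed.
Lemma innerDr x y z : <[x, y + z]> = <[x, y]> + <[x, z]>.
Proof. exact: linearDr. Qed.
Lemma innerZl k x y : <[k *: x, y]> = k * <[x, y]>.
Proof. by rewrite linearZl_LR. Qed.
Lemma innerZr k x y : <[x, k *: y]> = k^* * <[x, y]>.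
Proof. by rewrite linearZr_LR. Qed.
Lemma inner0l x : <[0, x]> = 0. Proof. exact: linear0l. Qed.
Lemma inner0r x : <[x, 0]> = 0. Proof. exact: linear0r. Qed.
Lemma innerNl x y : <[- x, y]> = - <[x, y]>. Proof. exact: linearNl. Qed.
Lemma innerNr x y : <[x, - y]> = - <[x, y]>. Proof. exact: linearNr. Qed.
Lemma innerBl x y z : <[x - y, z]> = <[x, z]> - <[y, z]>.
Proof. by rewrite innerDl innerNl. Qed.
Lemma innerBr x y z : <[x, y - z]> = <[x, y]> - <[x, z]>.
Proof. by rewrite innerDr innerNr. Qed.

Lemma inner_ge0 x : 0 <= <[x, x]>.
Proof. by rewrite innerxx exprn_ge0. Qed.

Lemma inner_eq0 x : (<[x, x]> == 0) = (x == 0).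
Proof. by rewrite innerxx expf_eq0/= normr_eq0. Qed.

Lemma inner_inj x y : (forall z, <[z, x]> = <[z, y]>) -> x = y.
Proof.
move=> xy; apply/eqP; rewrite -subr_eq0 -inner_eq0 innerBr xy subrr//.
Qed.

Lemma inner_CS x y : `|<[x, y]>| <= `|x| * `|y|.
Proof.
rewrite -(@ler_pXn2r _ 2%N)// ?nnegrE ?mulr_ge0// exprMn -!innerxx.
have [->|y0] := eqVneq y 0; first by rewrite !inner0r normr0 expr0n mulr0.
have yy0 : 0 < <[y, y]> by rewrite lt_def inner_eq0 y0 inner_ge0.
have := inner_ge0 (<[y, y]> *: x - <[x, y]> *: y).
rewrite innerBl !innerBr !innerZl !innerZr.
have -> : (<[y, y]>)^* = <[y, y]> by rewrite -innerC.
set c := <[x, y]>; set b := <[y, y]>; set a := <[x, x]>.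
have -> : <[y, x]> = c^* by rewrite innerC.
set X := (X in 0 <= X).
have -> : X = b * (a * b - `|c| ^+ 2).
  by rewrite /X normCK; ring.
by rewrite pmulr_rge0// subr_ge0.
Qed.

End Inner.

Section Riesz.
Context {R : realType} (H : hilbertType R).
Implicit Types (x y z : H) (a b : boundedOp H).

Lemma small_eq0 (c N : R[i]) : 0 <= N ->
  (forall e, 0 < e -> `|c| <= N * e) -> c = 0.
Proof.
move=> N0 cN; apply/eqP; rewrite -normr_le0; apply/ler_addgt0Pr => e e0.
have N1 : 0 < N + 1 by rewrite ltr_wpDl.
rewrite add0r (le_trans (cN _ (divr_gt0 e0 N1)))//.
by rewrite mulrCA ger_pMr// ler_pdivrMr// mul1r lerDl.
Qed.

Lemma small_eq0v x (N : R[i]) : 0 <= N ->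
  (forall e, 0 < e -> `|x| <= N * e) -> x = 0.
Proof.
move=> N0 cN; apply/normr0_eq0/(@small_eq0 _ N) => // e e0.
by rewrite normr_id cN.
Qed.

Lemma ge0_RRe (c : R[i]) : 0 <= c -> c = (complex.Re c)%:C%C.
Proof. by case: c => a b; rewrite lecE/= => /andP[/eqP -> _]. Qed.

Lemma riesz (f : H -> R[i]) (M : R[i]) : 0 <= M ->
  (forall k x y, f (k *: x + y) = k * f x + f y) ->
  (forall x, `|f x| <= M * `|x|) -> exists z, forall x, f x = <[x, z]>.
Proof.
move=> M0 lf fM.
have f0 : f 0 = 0.
  by apply/normr0_eq0/eqP; rewrite -normr_le0 normr_id (le_trans (fM 0))// normr0 mulr0.
have fZ k x : f (k *: x) = k * f x by rewrite -[k *: x]addr0 lf f0 addr0.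
have fD x y : f (x + y) = f x + f y by rewrite -[x in LHS]scale1r lf mul1r.
have fB x y : f (x - y) = f x - f y by rewrite -scaleN1r fD fZ mulN1r.
have [[x0 fx0]|nf] := pselect (exists x, f x != 0); last first.
  exists 0 => x; rewrite inner0r; apply/eqP/negPn/negP => fx.
  by apply: nf; exists x.
pose S := [set r : R | exists2 x, f x = 1 & `|x| ^+ 2 = r%:C%C].
have S0 : S !=set0.
  exists (complex.Re (`|(f x0)^-1 *: x0| ^+ 2)); exists ((f x0)^-1 *: x0).
    by rewrite fZ mulVf.
  by rewrite -ge0_RRe ?exprn_ge0.
have Slb : has_lbound S.
  by exists 0 => r [x _ xr]; rewrite -lecR -xr exprn_ge0.
pose d := inf S.
have dle x : f x = 1 -> d%:C%C <= `|x| ^+ 2.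
  move=> fx; rewrite (@ge0_RRe (`|x| ^+ 2)) ?exprn_ge0// lecR.
  by apply: ge_inf => //; exists x => //; rewrite -ge0_RRe ?exprn_ge0.
pose P (e : R[i]) x := f x = 1 /\ `|x| ^+ 2 <= d%:C%C + e ^+ 2 / 2.
have P0 e : 0 < e -> P e !=set0.
  move=> e0.
  have e20 : 0 < e ^+ 2 / 2 by rewrite divr_gt0 ?exprn_gt0.
  have re0 : 0 < complex.Re (e ^+ 2 / 2).
    by rewrite -ltcR -ge0_RRe// ltW.
  have [r [x fx xr] rd] := inf_adherent re0 (conj S0 Slb).
  exists x; split=> //; rewrite xr (ge0_RRe (ltW e20)) -rmorphD/= lecR.
  exact: ltW.
have dnd x y : f x = 1 -> f y = 0 -> `|<[x, y]>| ^+ 2 <= (`|x| ^+ 2 - d%:C%C) * `|y| ^+ 2.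
  move=> fx fy.
  have [->|y0] := eqVneq y 0; first by rewrite inner0r !normr0 !expr0n mulr0.
  have yy0 : 0 < <[y, y]> by rewrite lt_def inner_eq0 y0 inner_ge0.
  have := dle (x - (<[x, y]> / <[y, y]>) *: y).
  rewrite fB fZ fy mulr0 subr0 => /(_ fx).
  rewrite -!innerxx innerBl !innerBr !innerZl !innerZr.
  have -> : (<[x, y]> / <[y, y]>)^* = <[x, y]>^* / <[y, y]>.
    by rewrite rmorphM/= fmorphV/= -(innerC y y).
  rewrite (innerC y x) -subr_ge0 -[in X in _ -> X]subr_ge0.
  set X := (X in 0 <= X); set Y := (Y in _ -> 0 <= Y).
  have -> : Y = X * <[y, y]>.
    by rewrite /X /Y normCK; field; rewrite gt_eqF.
  by move=> X0; rewrite mulr_ge0// ltW.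
have PP e e' x y : 0 < e -> 0 < e' -> P e x -> P e' y -> `|x - y| <= e + e'.
  move=> e0 e'0 [fx xe] [fy ye].
  have fxy : f (2^-1 *: (x + y)) = 1.
    by rewrite fZ fD fx fy mulVf.
  have := dle _ fxy; rewrite normrZ exprMn gtr0_norm ?invr_gt0// => dxy.
  rewrite -(@ler_pXn2r _ 2%N)// ?nnegrE ?addr_ge0 ?(ltW e0) ?(ltW e'0)//.
  have -> : `|x - y| ^+ 2 = 2 * `|x| ^+ 2 + 2 * `|y| ^+ 2 - `|x + y| ^+ 2.
    rewrite -!innerxx !innerBl !innerBr !innerDl !innerDr.
    by ring.
  have : 4 * d%:C%C <= `|x + y| ^+ 2.
    rewrite mulrC -ler_pdivlMr// mulrC (le_trans dxy)// ler_wpM2r ?exprn_ge0//.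
    by rewrite exprVn -natrX.
  move=> h.
  have h2 : 2 * `|x| ^+ 2 + 2 * `|y| ^+ 2 <=
      2 * (d%:C%C + e ^+ 2 / 2) + 2 * (d%:C%C + e' ^+ 2 / 2).
    by rewrite lerD// ler_wpM2l.
  have h3 := lerB h2 h.
  apply: (le_trans h3).
  rewrite -subr_ge0; set X := (X in 0 <= X).
  have -> : X = 2 * e * e' by rewrite /X; field.
  by rewrite !mulr_ge0// ltW.
have [z zP] := complete_eps P0 PP.
have fz : f z = 1.
  apply/eqP; rewrite -subr_eq0; apply/eqP/(@small_eq0 _ M) => // e e0.
  have [x Px] := P0 _ e0.
  rewrite -(Px.1) -fB (le_trans (fM _))// ler_wpM2l// distrC.
  exact: zP.
have orth y : f y = 0 -> <[z, y]> = 0.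
  move=> fy; apply: (@small_eq0 _ (2 * `|y|)); first by rewrite mulr_ge0.
  move=> e e0; have [x Px] := P0 _ e0.
  rewrite -(subrK x z) innerDl (le_trans (ler_normD _ _))//.
  rewrite [2]mulr2n mulrDl mul1r mulrDl lerD//.
    rewrite (le_trans (inner_CS _ _))// mulrC ler_wpM2l// distrC.
    exact: zP.
  rewrite -(@ler_pXn2r _ 2%N)// ?nnegrE ?mulr_ge0// ?(ltW e0)//.
  rewrite (le_trans (dnd _ _ Px.1 fy))// mulrC exprMn ler_wpM2l ?exprn_ge0//.
  rewrite lerBlDl (le_trans Px.2)// lerD2l ler_pdivrMr//.
  by rewrite ler_peMr ?exprn_ge0 ?(ltW e0)// ler1n.
have z0 : <[z, z]> != 0.
  rewrite inner_eq0; apply/eqP => z0; move: fz; rewrite z0 f0 => /esym/eqP.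
  by rewrite oner_eq0.
exists (<[z, z]>^-1 *: z) => x.
rewrite innerZr fmorphV/= -(innerC z z).
have := orth (x - f x *: z); rewrite fB fZ fz mulr1 subrr => /(_ erefl).
rewrite innerBr innerZr => /eqP; rewrite subr_eq0 => /eqP xz.
have -> : <[x, z]> = f x * <[z, z]>.
  by rewrite innerC xz rmorphM/= conjCK -(innerC z z).
by rewrite mulrC mulfK.
Qed.

Definition is_adjoint (a b : boundedOp H) :=
  forall x y, <[a x, y]> = <[x, b y]>.

Lemma adjoint_exists a : exists b, is_adjoint a b.
Proof.
have [M M0 aM] := boundedOp_bounded a.
have ex y : exists z, forall x, <[a x, y]> = <[x, z]>.
  apply: (@riesz _ (M * `|y|)); first by rewrite mulr_ge0// ltW.
    by move=> k x x'; rewrite linearP innerDl innerZl.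
  by move=> x; rewrite (le_trans (inner_CS _ _))// mulrAC ler_wpM2r.
pose b y := projT1 (cid (ex y)).
have bP x y : <[a x, y]> = <[x, b y]> by rewrite /b; case: cid.
have [|x|b' b'b] := @bounded_boundedOp _ _ b M (ltW M0).
- move=> k x y; apply: inner_inj => z.
  by rewrite -bP innerDr innerZr !bP -innerZr -innerDr.
- have [->|bx0] := eqVneq (b x) 0; first by rewrite normr0 mulr_ge0// ltW.
  have nb : 0 < `|b x| by rewrite normr_gt0.
  have bb : `|b x| ^+ 2 = `|<[a (b x), x]>|.
    by rewrite bP ger0_norm ?inner_ge0// innerxx.
  rewrite -(ler_pM2l nb) -expr2 bb (le_trans (inner_CS _ _))//.
  by rewrite mulrCA mulrA ler_wpM2r.
by exists b' => x y; rewrite b'b.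
Qed.

(* xget picks the unique such b, which exists by adjoint_exists. *)
Definition adj a : boundedOp H := xget 0 [set b | is_adjoint a b].

Lemma adjP a x y : <[a x, y]> = <[x, adj a y]>.
Proof.
by have [b ab] := adjoint_exists a; exact: (xgetPex 0 (ex_intro _ b ab)).
Qed.

Lemma adj_unique a b : is_adjoint a b -> adj a = b.
Proof.
by move=> ab; apply: boundedOp_ext => y; apply: inner_inj => x; rewrite -adjP ab.
Qed.

Lemma adjK : involutive adj.
Proof.
by move=> a; apply: adj_unique => x y; rewrite innerC -adjP -innerC.
Qed.

Lemma adjM a b : adj (a * b) = adj b * adj a.
Proof. by apply: adj_unique => x y; rewrite !opME !adjP. Qed.

Lemma adj1 : adj 1 = 1.
Proof. exact: adj_unique. Qed.

End Riesz.

Definition total_in (R : realType) (X : Type) (H : hilbertType R) (u : X -> H) :=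
  closure [set \sum_(p <- s) u p | s in [set: seq X]] = setT.

Lemma total_inP (R : realType) (X : Type) (H : hilbertType R) (u : X -> H) z e :
  total_in u -> 0 < e -> exists s : seq X, `|z - \sum_(p <- s) u p| <= e.
Proof.
move=> /seteqP[_ /(_ z I)] zu e0.
have [_ [[s _ <-]]] := zu _ (nbhsx_ballx z e e0).
by rewrite -ball_normE /ball_/= => /ltW; exists s.
Qed.

Section Extension.
Context {R : realType} (X : Type) (H : hilbertType R).
Variables (u v : X -> H) (sc : R[i] -> X -> X) (M : R[i]).
Hypothesis M0 : 0 <= M.
Hypothesis uZ : forall k x, u (sc k x) = k *: u x.
Hypothesis vZ : forall k x, v (sc k x) = k *: v x.
Hypothesis u_total : total_in u.
Hypothesis vu : forall s : seq X,
  `|\sum_(p <- s) v p| <= M * `|\sum_(p <- s) u p|.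

Let U s := \sum_(p <- s) u p.
Let V s := \sum_(p <- s) v p.

Let comb k s t := map (sc k) s ++ t.

Let Ucomb k s t : U (comb k s t) = k *: U s + U t.
Proof.
by rewrite /U /comb big_cat big_map scaler_sumr; congr (_ + _); apply: eq_bigr.
Qed.

Let Vcomb k s t : V (comb k s t) = k *: V s + V t.
Proof.
by rewrite /V /comb big_cat big_map scaler_sumr; congr (_ + _); apply: eq_bigr.
Qed.

Let VU s t : `|V s - V t| <= M * `|U s - U t|.
Proof.
have := vu (comb (- 1) t s); rewrite -/(U _) -/(V _) Ucomb Vcomb !scaleN1r.
by rewrite ![- _ + _]addrC.
Qed.

Let ext_ex z : exists w, forall e s, 0 < e -> `|z - U s| <= e ->
  `|w - V s| <= (M + 1) * e.
Proof.
have M1 : 0 < M + 1 by rewrite ltr_wpDl.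
pose P (e : R[i]) w := exists2 s, `|z - U s| <= e / (M + 1) & w = V s.
have [||w wP] := @complete_eps _ _ P.
- move=> e e0; have [s sz] := total_inP z u_total (divr_gt0 e0 M1).
  by exists (V s); exists s.
- move=> e d _ _ e0 d0 [s zs ->] [t zt ->].
  rewrite (le_trans (VU _ _))// -(subrK z (U s)) -addrA.
  have h : `|U s - z + (z - U t)| <= e / (M + 1) + d / (M + 1).
    by rewrite (le_trans (ler_normD _ _))// lerD// distrC.
  rewrite (le_trans (ler_wpM2l M0 h))// -mulrDl mulrCA ger_pMr ?addr_gt0//.
  by rewrite ler_pdivrMr// mul1r lerDl.
exists w => e s e0 zs; rewrite distrC; apply: wP; first exact: mulr_gt0.
by exists s => //; rewrite mulrAC divff ?gt_eqF// mul1r.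
Qed.

Lemma extension : exists c : boundedOp H, forall x, c (u x) = v x.
Proof.
have M1 : 0 < M + 1 by rewrite ltr_wpDl.
pose c z := projT1 (cid (ext_ex z)).
have cP z e s : 0 < e -> `|z - U s| <= e -> `|c z - V s| <= (M + 1) * e.
  by move=> e0; rewrite /c; case: cid => /= w; exact.
have cl : linear c.
  move=> k x y; apply/eqP; rewrite -subr_eq0; apply/eqP.
  apply: (@small_eq0v _ _ _ ((M + 1) * (`|k| + 1) + `|k| * (M + 1) + (M + 1))).
    by rewrite !addr_ge0 ?mulr_ge0 ?addr_ge0.
  move=> e e0.
  have [s sx] := total_inP x u_total e0.
  have [t ty] := total_inP y u_total e0.
  rewrite -/(U _) in sx; rewrite -/(U _) in ty.
  have ke0 : 0 < (`|k| + 1) * e by rewrite mulr_gt0// ltr_wpDl.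
  have h : `|k *: x + y - U (comb k s t)| <= (`|k| + 1) * e.
    rewrite Ucomb opprD addrACA -scalerBr (le_trans (ler_normD _ _))//.
    by rewrite normrZ mulrDl mul1r lerD// ler_wpM2l.
  have -> : c (k *: x + y) - (k *: c x + c y) =
      (c (k *: x + y) - V (comb k s t)) + k *: (V s - c x) + (V t - c y).
    rewrite Vcomb scalerBr -!addrA; congr (_ + _).
    rewrite !opprD -!addrA.
    rewrite [in RHS](addrCA (- V t)) [in RHS](addrCA (- V t)).
    by rewrite (addrA (- V t)) addNr add0r addrA addNr add0r.
  set N := (X in _ <= X).
  have -> : N = (M + 1) * ((`|k| + 1) * e) + `|k| * ((M + 1) * e) + (M + 1) * e.
    by rewrite /N; ring.
  rewrite (le_trans (ler_normD _ _))// lerD//; last first.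
    by rewrite distrC; apply: cP.
  rewrite (le_trans (ler_normD _ _))// lerD//; first exact: cP.
  by rewrite normrZ ler_wpM2l// distrC; apply: cP.
have cb x : `|c x| <= M * `|x|.
  apply/ler_addgt0Pr => e e0.
  have M2 : 0 < M + 1 + M by rewrite ltr_wpDr.
  have d0 := divr_gt0 e0 M2.
  have [s sx] := total_inP x u_total d0.
  rewrite -(subrK (V s) (c x)) (le_trans (ler_normD _ _))//.
  have h1 := cP _ _ _ d0 sx.
  have h2 : `|V s| <= M * (`|x| + e / (M + 1 + M)).
    rewrite (le_trans (vu s))// ler_wpM2l// -/(U s) -[U s](subrK x).
    by rewrite addrC (le_trans (ler_normD _ _))// lerD// distrC.
  apply: (le_trans (lerD h1 h2)).
  by rewrite mulrDr addrCA -mulrDl mulrCA divff ?gt_eqF// mulr1.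
have [c' c'c] := bounded_boundedOp M0 cl cb.
exists c' => x; rewrite c'c; apply/eqP; rewrite -subr_eq0; apply/eqP.
apply: (@small_eq0v _ _ _ (M + 1)); first exact: ltW.
move=> e e0; have := cP (u x) e [:: x] e0.
by rewrite /U /V !big_seq1 subrr normr0; apply; exact: ltW.
Qed.

End Extension.

Section GramSchmidt.
Context {R : realType}.

Fixpoint onb (Y : hilbertType R) (o : seq Y) : Prop :=
  if o is f :: o' then
    [/\ <[f, f]> = 1, forall g, g \in o' -> <[g, f]> = 0 & onb o']
  else True.

Lemma inner_suml (Y : hilbertType R) (I : Type) (s : seq I) (F : I -> Y) y :
  <[\sum_(i <- s) F i, y]> = \sum_(i <- s) <[F i, y]>.
Proof.
by elim: s => [|i s IH]; rewrite ?big_nil ?inner0l// !big_cons innerDl IH.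
Qed.

Lemma onb_proj (Y : hilbertType R) (o : seq Y) y f : onb o -> f \in o ->
  <[\sum_(g <- o) <[y, g]> *: g, f]> = <[y, f]>.
Proof.
elim: o => //= g o IH [gg go oo]; rewrite inE big_cons innerDl innerZl.
move=> /predU1P[->|fo].
  rewrite gg mulr1 inner_suml big_seq big1 ?addr0// => h ho.
  by rewrite innerZl go// mulr0.
by rewrite IH// (innerC g f) (go f fo) conjC0 mulr0 add0r.
Qed.

Lemma gram_schmidt (X Y : hilbertType R) (s : seq (X * Y)) :
  exists2 s' : seq (X * Y), onb (map snd s') &
  forall (W : lmodType R[i]) (B : X -> Y -> W),
    (forall y, linear (B^~ y)) -> (forall x, linear (B x)) ->
    \sum_(p <- s) B p.1 p.2 = \sum_(p <- s') B p.1 p.2.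
Proof.
elim: s => [|[x y] s [s' os' ss']]; first by exists [::].
pose r := y - \sum_(g <- map snd s') <[y, g]> *: g.
pose s2 := map (fun q => (q.1 + <[y, q.2]> *: x, q.2)) s'.
have s2E : map snd s2 = map snd s' by rewrite /s2 -map_comp; apply: eq_map.
have s2B (W : lmodType R[i]) (B : X -> Y -> W) :
    (forall y, linear (B^~ y)) -> (forall x, linear (B x)) ->
    \sum_(p <- (x, y) :: s) B p.1 p.2 = B x r + \sum_(p <- s2) B p.1 p.2.
  move=> Bl Br; rewrite big_cons (ss' _ B)//= /s2 big_map/=.
  have BlD z u v : B (u + v) z = B u z + B v z.
    by have := Bl z 1 u v; rewrite /= !scale1r.
  have Bl0 z : B 0 z = 0.
    by apply: (addIr (B 0 z)); rewrite -BlD !add0r.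
  have BlZ z k u : B (k *: u) z = k *: B u z.
    by have := Bl z k u 0; rewrite /= !addr0 Bl0 addr0.
  have BrD z u v : B z (u + v) = B z u + B z v.
    by have := Br z 1 u v; rewrite /= !scale1r.
  have Br0 z : B z 0 = 0.
    by apply: (addIr (B z 0)); rewrite -BrD !add0r.
  have BrZ z k u : B z (k *: u) = k *: B z u.
    by have := Br z k u 0; rewrite /= !addr0 Br0 addr0.
  have Brs (t : seq (X * Y)) : B x (\sum_(g <- map snd t) <[y, g]> *: g) =
      \sum_(q <- t) B (<[y, q.2]> *: x) q.2.
    elim: t => [|q t IH]; first by rewrite /= !big_nil Br0.
    by rewrite /= !big_cons BrD IH BrZ BlZ.
  under [in RHS]eq_bigr do rewrite BlD.
  rewrite big_split/= -Brs addrCA -BrD addrC. congr (_ + _).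
  by rewrite /r subrK.
have [r0|r0] := eqVneq r 0.
  exists s2; first by rewrite s2E.
  move=> W B Bl Br; rewrite s2B// r0.
  have -> : B x 0 = 0.
    have := Br x 1 0 0; rewrite /= !scale1r addr0 => /esym/eqP.
    by rewrite -subr_eq0 addrK => /eqP.
  by rewrite add0r.
have nr : `|r| != 0 by rewrite normr_eq0.
exists ((`|r| *: x, `|r|^-1 *: r) :: s2); last first.
  move=> W B Bl Br; rewrite s2B// [RHS]big_cons/=; congr (_ + _).
  have -> : B (`|r| *: x) (`|r|^-1 *: r) = `|r| *: (`|r|^-1 *: B x r).
    have Bl0 z : B 0 z = 0.
      have := Bl z 1 0 0; rewrite /= !scale1r addr0 => /esym/eqP.
      by rewrite -subr_eq0 addrK => /eqP.
    have Br0 z : B z 0 = 0.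
      have := Br z 1 0 0; rewrite /= !scale1r addr0 => /esym/eqP.
      by rewrite -subr_eq0 addrK => /eqP.
    have := Bl (`|r|^-1 *: r) `|r| x 0; rewrite /= !addr0 Bl0 addr0 => ->.
    by have := Br x `|r|^-1 r 0; rewrite !addr0 Br0 addr0 => ->.
  by rewrite scalerA mulfV// scale1r.
rewrite /= s2E; split => // [|g gs].
  rewrite innerZl innerZr geC0_conj ?invr_ge0// innerxx.
  by rewrite mulrA -expr2 -exprMn mulVf// expr1n.
rewrite innerC innerZl /r innerBl onb_proj// subrr mulr0.
exact: conjC0.
Qed.

End GramSchmidt.

Section TensorBound.
Context {R : realType} (X Y K : hilbertType R) (B : X -> Y -> K).
Hypothesis Bl : forall y, linear (B^~ y).
Hypothesis Br : forall x, linear (B x).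
Hypothesis BI : forall x x' y y', <[B x y, B x' y']> = <[x, x']> * <[y, y']>.

Lemma onb_norm (s : seq (X * Y)) : onb (map snd s) ->
  `|\sum_(p <- s) B p.1 p.2| ^+ 2 = \sum_(p <- s) `|p.1| ^+ 2.
Proof.
elim: s => [|[x f] s IH] /=; first by rewrite !big_nil normr0 expr0n.
case=> ff fs os; rewrite !big_cons/= -IH// -!innerxx.
set S := \sum_(_ <- _) _.
have Sf : <[S, B x f]> = 0.
  rewrite inner_suml big_seq big1// => q qs.
  by rewrite BI fs ?mulr0//; apply: map_f.
by rewrite innerDl !innerDr Sf (innerC _ S) Sf conjC0 BI ff mulr1 addr0 add0r.
Qed.

Lemma tens_bound (a : boundedOp X) M (s : seq (X * Y)) : 0 <= M ->
  (forall x, `|a x| <= M * `|x|) ->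
  `|\sum_(p <- s) B (a p.1) p.2| <= M * `|\sum_(p <- s) B p.1 p.2|.
Proof.
move=> M0 aM; have [s' os' ss'] := gram_schmidt s.
rewrite (ss' _ B)// (ss' _ (fun x y => B (a x) y))//; last first.
  by move=> y k x x'; rewrite linearP Bl.
rewrite -(@ler_pXn2r _ 2%N)// ?nnegrE ?mulr_ge0// exprMn onb_norm//.
have -> : \sum_(p <- s') B (a p.1) p.2 =
    \sum_(p <- map (fun p => (a p.1, p.2)) s') B p.1 p.2 by rewrite big_map.
rewrite onb_norm; last by rewrite -map_comp.
rewrite big_map mulr_sumr; apply: ler_sum => p _ /=.
by rewrite -exprMn ler_pXn2r ?nnegrE ?mulr_ge0.
Qed.

End TensorBound.

(* This determines K up to a unique unitary: the vectors tens x y span a dense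
   subspace. Sums without scalars suffice in total_in since k *: tens x y is
   tens (k *: x) y. *)
Record hilbert_tensor (R : realType) (H1 H2 K : hilbertType R) := HilbertTensor {
  tens :> {bilinear H1 -> H2 -> K} ;
  inner_tens : forall x x' y y',
    <[tens x y, tens x' y']> = <[x, x']> * <[y, y']> ;
  tens_total : total_in (fun p : H1 * H2 => tens p.1 p.2) }.

Section TensorOp.
Context {R : realType} (H1 H2 K : hilbertType R) (t : hilbert_tensor H1 H2 K).

Definition is_tensor_op (a : boundedOp H1) (b : boundedOp H2) (c : boundedOp K) :=
  forall x y, c (t x y) = t (a x) (b y).

Lemma tensor_op_exists a b : exists c, is_tensor_op a b c.
Proof.
have [M M0 aM] := boundedOp_bounded a.
have [N N0 bN] := boundedOp_bounded b.
have tl y : linear (t^~ y) by move=> k x x'; rewrite linearPl.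
have tr x : linear (t x) by move=> k y y'; rewrite linearPr.
have [|||||c cE] := @extension R _ K (fun p : H1 * H2 => t p.1 p.2)
    (fun p => t (a p.1) (b p.2)) (fun k p => (k *: p.1, p.2)) (M * N).
- by rewrite mulr_ge0 ?ltW.
- by move=> k p /=; rewrite linearZl_LR.
- by move=> k p /=; rewrite linearZ linearZl_LR.
- exact: tens_total.
- move=> s.
  have h1 := tens_bound tl tr (inner_tens t)
    (map (fun p : H1 * H2 => (p.1, b p.2)) s) (ltW M0) aM.
  have h2 := @tens_bound R H2 H1 K (fun y x => t x y) tr tl
    (fun y y' x x' => etrans (inner_tens t x x' y y') (mulrC _ _)) b N
    (map (fun p : H1 * H2 => (p.2, p.1)) s) (ltW N0) bN.
  rewrite !big_map/= in h1 h2.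
  by rewrite -mulrA (le_trans h1)// ler_wpM2l// ltW.
- by exists c => x y; have := cE (x, y).
Qed.

Definition tensor_op a b : boundedOp K := xget 0 [set c | is_tensor_op a b c].

Lemma tensor_opE a b x y : tensor_op a b (t x y) = t (a x) (b y).
Proof.
by have [c cP] := tensor_op_exists a b; exact: (xgetPex 0 (ex_intro _ c cP)).
Qed.

Lemma boundedOp_tens_ext (c d : boundedOp K) :
  (forall x y, c (t x y) = d (t x y)) -> c = d.
Proof.
move=> cd; apply: boundedOp_ext => z; apply/eqP; rewrite -subr_eq0; apply/eqP.
have [M M0 cM] := boundedOp_bounded (c - d).
apply: (@small_eq0v _ _ _ M); first exact: ltW.
move=> e e0; have [s sz] := total_inP z (@tens_total _ _ _ _ t) e0.
have cdD x y : (c - d) (x + y) = (c - d) x + (c - d) y by exact: raddfD.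
have S0 : (c - d) (\sum_(p <- s) t p.1 p.2) = 0.
  elim: (s) => [|p s' IH]; first by rewrite big_nil; exact: raddf0.
  by rewrite big_cons cdD IH addr0 opDE opNE cd subrr.
rewrite -opNE -opDE -(subrK (\sum_(p <- s) t p.1 p.2) z) cdD S0 addr0.
by rewrite (le_trans (cM _))// ler_wpM2l// ltW.
Qed.

End TensorOp.

Section Flip.
Context {R : realType} (H K : hilbertType R) (t : hilbert_tensor H H K).

Lemma flip_exists : exists s : boundedOp K, forall x y, s (t x y) = t y x.
Proof.
have [|||||c cE] := @extension R _ K (fun p : H * H => t p.1 p.2)
    (fun p => t p.2 p.1) (fun k p => (k *: p.1, p.2)) 1.
- exact: ler01.
- by move=> k p /=; rewrite linearZl_LR.
- by move=> k p /=; rewrite linearZr_LR.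
- exact: tens_total.
- move=> s; rewrite mul1r le_eqVlt; apply/orP; left.
  rewrite -(@eqrXn2 _ 2%N)// -!innerxx; apply/eqP; rewrite !inner_suml.
  apply: eq_bigr => p _; rewrite innerC [RHS]innerC !inner_suml; congr (_^*).
  by apply: eq_bigr => q _; rewrite !inner_tens mulrC.
- by exists c => x y; have := cE (x, y).
Qed.

Definition flip : boundedOp K := 
  xget (0 : boundedOp K) [set s : boundedOp K | forall x y, s (t x y) = t y x].

Lemma flipE x y : flip (t x y) = t y x.
Proof.
have [c cP] := flip_exists; rewrite /flip.
by case: xgetP => [s _ /(_ x y)//|/(_ c)]; case.
Qed.

End Flip.

Section MultiplicativeUnitary.
Context {R : realType} (H HH HHH : hilbertType R).

(* H (x) H (x) H, read both as (H (x) H) (x) H and as H (x) (H (x) H). *)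
Record hilbert_tensor3 (t : hilbert_tensor H H HH) := HilbertTensor3 {
  tens_l : hilbert_tensor HH H HHH ;
  tens_r : hilbert_tensor H HH HHH ;
  tensA : forall x y z, tens_l (t x y) z = tens_r x (t y z) }.

Variables (t : hilbert_tensor H H HH) (t3 : hilbert_tensor3 t).
Implicit Type a : boundedOp HH.

Definition leg12 a : boundedOp HHH := tensor_op (tens_l t3) a 1.
Definition leg23 a : boundedOp HHH := tensor_op (tens_r t3) 1 a.
Definition leg13 a : boundedOp HHH :=
  leg12 (flip t) * leg23 a * leg12 (flip t).

Lemma leg12E a x y z : leg12 a (tens_l t3 (t x y) z) = tens_l t3 (a (t x y)) z.
Proof. exact: tensor_opE. Qed.

Lemma leg23E a x y z : leg23 a (tens_r t3 x (t y z)) = tens_r t3 x (a (t y z)).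
Proof. exact: tensor_opE. Qed.

Definition unitary (K : hilbertType R) (u : boundedOp K) :=
  adj u * u = 1 /\ u * adj u = 1.

Definition multiplicative_unitary (u : boundedOp HH) :=
  unitary u /\ leg12 u * leg13 u * leg23 u = leg23 u * leg12 u.

End MultiplicativeUnitary.

Section CstarAlgebra.
Context {R : realType}.
Implicit Types H K : hilbertType R.

(* Closure for the operator norm: `|a x - b x| <= e * `|x| for all x says
   that the norm of a - b is at most e. *)
Definition op_closure H (S : set (boundedOp H)) : set (boundedOp H) :=
  [set a | forall e : R[i], 0 < e ->
    exists2 b, S b & forall x, `|a x - b x| <= e * `|x|].

Record cstar_subalgebra H (A : set (boundedOp H)) : Prop := CstarSubalgebra {
  cstar0 : A 0 ;
  cstar_linear : forall (k : R[i]) a b, A a -> A b -> A (k *: a + b) ;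
  cstar_mul : forall a b, A a -> A b -> A (a * b) ;
  cstar_adj : forall a, A a -> A (adj a) ;
  cstar_closed : op_closure A `<=` A }.

Definition cstar_generated H (S : set (boundedOp H)) : set (boundedOp H) :=
  [set a | forall A, cstar_subalgebra A -> S `<=` A -> A a].

(* The minimal tensor product of two concrete C*-algebras A and B is the
   closed linear span of the a (x) b in B(H1 (x) H2). *)
Definition min_tensor H1 H2 K (t : hilbert_tensor H1 H2 K)
    (A : set (boundedOp H1)) (B : set (boundedOp H2)) : set (boundedOp K) :=
  op_closure [set \sum_(p <- s) tensor_op t p.1 p.2 |
    s in [set s : seq (boundedOp H1 * boundedOp H2) |
      forall p, p \in s -> A p.1 /\ B p.2]].

(* Only the values of phi on A matter. *)
Record unital_star_hom H K (A : set (boundedOp H)) (B : set (boundedOp K))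
    (phi : boundedOp H -> boundedOp K) : Prop := UnitalStarHom {
  star_hom_into : forall a, A a -> B (phi a) ;
  star_hom_linear : forall (k : R[i]) a b, A a -> A b ->
    phi (k *: a + b) = k *: phi a + phi b ;
  star_hom_mul : forall a b, A a -> A b -> phi (a * b) = phi a * phi b ;
  star_hom_adj : forall a, A a -> phi (adj a) = adj (phi a) ;
  star_hom1 : phi 1 = 1 }.

Record state H (A : set (boundedOp H)) (h : boundedOp H -> R[i]) : Prop := State {
  state_linear : forall (k : R[i]) a b, A a -> A b ->
    h (k *: a + b) = k * h a + h b ;
  state_ge0 : forall a, A a -> 0 <= h (adj a * a) ;
  state1 : h 1 = 1 }.

(* Lambda is the canonical map from A to the completion K of A / N_h, where
   N_h = {a | h (adj a * a) = 0}, and pi is the action by left multiplication. *)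
Record gns_representation H K (A : set (boundedOp H)) (h : boundedOp H -> R[i])
    (Lambda : boundedOp H -> K) (pi : boundedOp H -> boundedOp K) : Prop :=
  GnsRepresentation {
  gns_linear : forall (k : R[i]) a b, A a -> A b ->
    Lambda (k *: a + b) = k *: Lambda a + Lambda b ;
  gns_inner : forall a b, A a -> A b ->
    <[Lambda a, Lambda b]> = h (adj b * a) ;
  gns_dense : closure (Lambda @` A) = setT ;
  gns_hom : unital_star_hom A setT pi ;
  gns_mul : forall a b, A a -> A b -> pi a (Lambda b) = Lambda (a * b) }.

End CstarAlgebra.

Section Toeplitz.
Context {R : realType} (E : hilbertType R).

Definition orthonormal_basis (e : nat -> E) :=
  (forall m n, <[e m, e n]> = (m == n)%:R) /\
  total_in (fun p : R[i] * nat => p.1 *: e p.2).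

Definition toeplitz_algebra (T : boundedOp E) : set (boundedOp E) :=
  cstar_generated [set T].

End Toeplitz.

(* Main.v *)
Require Import Defs.
From HB Require Import structures.
From mathcomp Require Import all_boot all_order all_algebra sesquilinear complex.
From mathcomp Require Import all_classical all_reals all_analysis.

(** Write e_n for the basis vectors and s, g_n for objects built from a unitary
u as below.

The GNS space is identified first. Since T T^* is killed by h and T^* T = 1,
the rank one projection P = 1 - T T^* onto e_0 has h P = 1, and P a P is
<[a e_0, e_0]> P. As T^* represents the zero vector of the GNS space, a and
a P represent the same vector, so [gns_vacuum]: h is the vector state of e_0,
the vectors f_n = Lambda (T^n) form an orthonormal basis, and pi T is again the
unilateral shift S of this basis.

It remains to show [no_multiplicative_unitary_shift]: for the shift S of an
orthonormal basis f, no multiplicative unitary u satisfies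
u (S (x) 1) = (S (x) S) u. Such a u maps f_0 (x) H, the kernel of S^* (x) 1,
onto the kernel of S^* (x) S^*, the closed span of the f_0 (x) x and the
f_n (x) f_0. So there are s x and g_n with
  u (f_0 (x) s x) = f_0 (x) x   and   u (f_0 (x) g_n) = f_n (x) f_0,
where s is isometric, the g_n are unit vectors, and g_n is orthogonal to the
range of s for n >= 1. The pentagon equation at f_0 (x) g_n (x) s x and at
f_0 (x) g_1 (x) g_(n+1) gives
  u (g_n (x) s x) = g_n (x) s x   and   u (g_1 (x) g_(n+1)) = s f_n (x) g_1.
Taking inner products of these with u (f_0 (x) s y) = f_0 (x) y:
- <[f_0, g_n]> <[y, s x]> = <[f_0, g_n]> <[y, x]> for all x, y; if
  <[f_0, g_n]> <> 0 then s is the identity, against g_n being orthogonal to its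
  range. Hence f_0 is orthogonal to all g_n, n >= 1.
- <[f_0, s f_n]> <[f_j, g_1]> = <[f_0, g_1]> <[s f_j, g_(n+1)]> = 0; some
  <[f_j, g_1]> is nonzero, so f_0 is orthogonal to all s f_n.
Both together make u (f_0 (x) f_0) orthogonal to the kernel of S^* (x) S^*, in
which it lies. So it vanishes, and u is not isometric. *)

Import Order.TTheory GRing.Theory Num.Theory.
Import numFieldNormedType.Exports.

Local Open Scope classical_set_scope.
Local Open Scope ring_scope.

(** * Total families and orthonormal bases *)

Section Total.
Context {R : realType}.

Lemma total_in_inj {X : Type} {H : hilbertType R} {v : X -> H} {z w} :
  total_in v -> (forall p, <[z, v p]> = <[w, v p]>) -> z = w.
Proof.
move=> vt zw; apply/eqP; rewrite -subr_eq0 -inner_eq0; apply/eqP.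
apply: (@small_eq0 _ _ `|z - w|) => // e e0.
have [s sz] := total_inP (z - w) vt e0.
have orth : <[z - w, \sum_(p <- s) v p]> = 0.
  rewrite innerC inner_suml big1 ?conjC0// => p _.
  by rewrite innerC innerBl zw subrr conjC0.
rewrite -[X in <[_, X]>](subrK (\sum_(p <- s) v p)) innerDr orth addr0.
by rewrite (le_trans (inner_CS _ _))// ler_wpM2l.
Qed.

Lemma dense_total_in {X : Type} {H : hilbertType R} {v : X -> H} :
  (forall z e, 0 < e -> exists s : seq X, `|z - \sum_(p <- s) v p| <= e) ->
  total_in v.
Proof.
move=> vd; apply/seteqP; split=> // z _ B /nbhs_ballP[e /= e0 eB].
have [s zs] := vd z (e / 2) (divr_gt0 e0 (ltr0Sn _ 1)).
exists (\sum_(p <- s) v p); split; first by exists s.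
apply: eB; rewrite -ball_normE /ball_/= (le_lt_trans zs)//.
by rewrite [ltRHS]splitr ltrDl divr_gt0.
Qed.

Lemma basis_inj {H : hilbertType R} {e : nat -> H} {z w} :
  orthonormal_basis e -> (forall n, <[z, e n]> = <[w, e n]>) -> z = w.
Proof.
move=> [_ et] zw; apply: (total_in_inj et) => -[k n] /=.
by rewrite !innerZr zw.
Qed.

Lemma basis_norm {H : hilbertType R} {e : nat -> H} n :
  orthonormal_basis e -> `|e n| = 1.
Proof.
move=> he; apply/eqP.
by rewrite -(@eqrXn2 _ 2%N)// -innerxx he.1 eqxx expr1n.
Qed.

Lemma basis_op_inj {H : hilbertType R} {e : nat -> H} {a b : boundedOp H} :
  orthonormal_basis e -> (forall n, a (e n) = b (e n)) -> a = b.
Proof.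
move=> he ab; apply: boundedOp_ext => x; apply: inner_inj => y.
have adjE (c : boundedOp H) v w : <[adj c v, w]> = <[v, c w]>.
  by rewrite adjP adjK.
rewrite -!adjE; congr <[_, _]>; apply: (basis_inj he) => n.
by rewrite !adjE ab.
Qed.

End Total.

(** * The unilateral shift *)

Lemma adj_defect {R : realType} {H : hilbertType R} (a : boundedOp H) :
  adj (1 - a * adj a) = 1 - a * adj a.
Proof.
apply: adj_unique => y z; rewrite !opDE !opNE !op1E innerBl innerBr !opME.
by rewrite (adjP a) (adjP (adj a)) adjK.
Qed.

Section Shift.
Context {R : realType} {H : hilbertType R} {f : nat -> H} {S : boundedOp H}.
Hypothesis hf : orthonormal_basis f.
Hypothesis hS : forall n, S (f n) = f n.+1.

Lemma adj_shift0 : adj S (f 0%N) = 0.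
Proof.
by apply: (basis_inj hf) => n; rewrite adjP adjK hS hf.1 inner0l.
Qed.

Lemma adj_shiftS n : adj S (f n.+1) = f n.
Proof.
by apply: (basis_inj hf) => m; rewrite adjP adjK hS !hf.1 eqSS.
Qed.

Lemma shift_isometry : adj S * S = 1.
Proof. by apply: (basis_op_inj hf) => n; rewrite opME hS adj_shiftS. Qed.

(** Both sides see only the corner of a at f_0, because 1 - S S^* is the
orthogonal projection onto that vector. *)
Lemma shift_defect (a : boundedOp H) : let P := 1 - S * adj S in
  P * a * P = <[a (f 0%N), f 0%N]> *: P.
Proof.
move=> P.
have P0 : P (f 0%N) = f 0%N by rewrite opDE opNE opME adj_shift0 raddf0 subr0.
have PS n : P (f n.+1) = 0 by rewrite opDE opNE opME adj_shiftS hS subrr.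
have PE x : P x = <[x, f 0%N]> *: f 0%N.
  apply: (basis_inj hf) => n; rewrite innerZl hf.1.
  rewrite adjP adj_defect -/P; case: n => [|n]; first by rewrite P0 mulr1.
  by rewrite PS inner0r mulr0.
apply: (basis_op_inj hf) => -[|n]; first by rewrite !opME opZE P0 PE.
by rewrite !opME opZE PS !raddf0.
Qed.

End Shift.

(** * Tensor products *)

Section Tensor.
Context {R : realType} {H1 H2 K : hilbertType R} (t : hilbert_tensor H1 H2 K).

Lemma tens_inj {z w : K} :
  (forall x y, <[z, t x y]> = <[w, t x y]>) -> z = w.
Proof. by move=> zw; apply: (total_in_inj (tens_total t)) => -[x y]. Qed.

Lemma tens_norm x y : `|t x y| = `|x| * `|y|.
Proof.
apply/eqP; rewrite -(@eqrXn2 _ 2%N) ?mulr_ge0// exprMn -!innerxx.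
by rewrite inner_tens.
Qed.

(** Slices of a vector of the tensor product exist by the Riesz theorem; they
reduce statements about elementary tensors to one factor at a time. *)
Lemma slice_l y z : exists v, forall x, <[t x y, z]> = <[x, v]>.
Proof.
apply: (@riesz _ _ _ (`|y| * `|z|)) => [|k x x'|x]; first by rewrite mulr_ge0.
  by rewrite linearPl innerDl innerZl.
by rewrite (le_trans (inner_CS _ _))// tens_norm -mulrA [leRHS]mulrC.
Qed.

Lemma slice_r x z : exists v, forall y, <[t x y, z]> = <[y, v]>.
Proof.
apply: (@riesz _ _ _ (`|x| * `|z|)) => [|k y y'|y]; first by rewrite mulr_ge0.
  by rewrite linearPr innerDl innerZl.
by rewrite (le_trans (inner_CS _ _))// tens_norm mulrAC.
Qed.

Lemma tens_basisl_inj {e : nat -> H1} {z w : K} : orthonormal_basis e ->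
  (forall n y, <[z, t (e n) y]> = <[w, t (e n) y]>) -> z = w.
Proof.
move=> he zw; apply: tens_inj => x y.
have [v vP] := slice_l y z; have [v' vP'] := slice_l y w.
rewrite innerC vP [RHS]innerC vP'; congr (<[_, _]>^*).
apply: (basis_inj he) => n.
by rewrite innerC -vP -innerC zw innerC vP' -innerC.
Qed.

Lemma tens_basis_inj {e1 : nat -> H1} {e2 : nat -> H2} {z w : K} :
  orthonormal_basis e1 -> orthonormal_basis e2 ->
  (forall n m, <[z, t (e1 n) (e2 m)]> = <[w, t (e1 n) (e2 m)]>) -> z = w.
Proof.
move=> he1 he2 zw; apply: (tens_basisl_inj he1) => n y.
have [v vP] := slice_r (e1 n) z; have [v' vP'] := slice_r (e1 n) w.
rewrite innerC vP [RHS]innerC vP'; congr (<[_, _]>^*).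
apply: (basis_inj he2) => m.
by rewrite innerC -vP -innerC zw innerC vP' -innerC.
Qed.

Lemma adj_tensor (a : boundedOp H1) (b : boundedOp H2) :
  adj (tensor_op t a b) = tensor_op t (adj a) (adj b).
Proof.
apply: (@boundedOp_tens_ext _ _ _ _ t) => x y; apply: tens_inj => x' y'.
rewrite tensor_opE innerC -adjP tensor_opE !inner_tens rmorphM/=.
by rewrite (adjP a) (adjP b) -!innerC.
Qed.

Lemma tens_unit_injr x : <[x, x]> = 1 -> injective (t x).
Proof.
move=> x1 y y' /(congr1 (fun z => z - t x y')); rewrite subrr -linearB => /eqP.
rewrite -inner_eq0 inner_tens x1 mul1r inner_eq0 subr_eq0.
by move/eqP.
Qed.

(** A vector killed by the adjoint of S (x) 1 is orthogonal to e_(n+1) (x) y,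
which is the image of e_n (x) y, so it equals its slice along e_0. *)
Lemma ker_adj_shift_tens {e : nat -> H1} {S : boundedOp H1} {z : K} :
  orthonormal_basis e -> (forall n, S (e n) = e n.+1) ->
  tensor_op t (adj S) 1 z = 0 -> exists y, z = t (e 0%N) y.
Proof.
move=> he hS Sz.
have [y yP] := slice_r (e 0%N) z; exists y.
apply: (tens_basisl_inj he) => -[|n] w.
  by rewrite innerC yP inner_tens he.1 eqxx mul1r -innerC.
rewrite [RHS]inner_tens he.1 mul0r -hS.
have -> : t (S (e n)) w = adj (tensor_op t (adj S) 1) (t (e n) w).
  by rewrite adj_tensor adjK tensor_opE Defs.adj1.
by rewrite -adjP Sz inner0l.
Qed.

End Tensor.

(** * The pentagon equation *)

Section Legs.
Context {R : realType} {H HH HHH : hilbertType R}.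
Context {t : hilbert_tensor H H HH} (t3 : hilbert_tensor3 HHH t).

Lemma tensor_op_inj {H1 H2 K : hilbertType R} (s : hilbert_tensor H1 H2 K)
    {a a' : boundedOp H1} {b b' : boundedOp H2} :
  a' * a = 1 -> b' * b = 1 -> injective (tensor_op s a b).
Proof.
move=> a1 b1; apply: (can_inj (g := tensor_op s a' b')) => z.
suff ab1 : tensor_op s a' b' * tensor_op s a b = 1 by rewrite -opME ab1.
apply: (@boundedOp_tens_ext _ _ _ _ s) => x y.
by rewrite opME !tensor_opE -!opME a1 b1.
Qed.

Lemma flipK : flip t * flip t = 1.
Proof.
by apply: (@boundedOp_tens_ext _ _ _ _ t) => x y; rewrite opME !flipE.
Qed.

Lemma leg13E {a : boundedOp HH} {x y z x' z'} : a (t x z) = t x' z' ->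
  leg13 t3 a (tens_l t3 (t x y) z) = tens_l t3 (t x' y) z'.
Proof.
by move=> axz; rewrite !opME leg12E flipE tensA leg23E axz -tensA leg12E flipE.
Qed.

(** Evaluate the pentagon equation at x (x) y (x) z. Its right-hand side is the
one in the hypothesis, so u_12 u_13 takes the same value at
x (x) u (y (x) z) and at x (x) (v (x) w); being injective, it can be cancelled,
and so can the unit vector x. *)
Lemma pentagon_cancel {u : boundedOp HH} {x y z b c v w} :
  multiplicative_unitary t3 u -> `|x| = 1 -> u (t x y) = t b c ->
  leg12 t3 u (leg13 t3 u (tens_l t3 (t x v) w)) =
    leg23 t3 u (tens_l t3 (t b c) z) ->
  u (t y z) = t v w.
Proof.
move=> [[ul _] pent] x1 uxy uvw.
have inj12 : injective (leg12 t3 u) by apply: (tensor_op_inj _ ul (mulr1 1)).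
have injF : injective (leg12 t3 (flip t)).
  by apply: (tensor_op_inj _ flipK (mulr1 1)).
have inj13 : injective (leg13 t3 u).
  have inj23 : injective (leg23 t3 u) by apply: (tensor_op_inj _ (mulr1 1) ul).
  by move=> p q; rewrite !opME => /injF/inj23/injF.
have xx : <[x, x]> = 1 by rewrite innerxx x1 expr1n.
apply: (@tens_unit_injr _ _ _ _ (tens_r t3) _ xx).
apply: inj13; apply: inj12; rewrite -[in RHS]tensA uvw -uxy -leg12E.
by rewrite -[RHS]opME -pent !opME tensA leg23E.
Qed.

End Legs.

(** * Shifts admit no multiplicative unitary *)

Section NoMultiplicativeUnitary.
Context {R : realType} {H HH HHH : hilbertType R}.
Context {f : nat -> H} {S : boundedOp H}.
Hypothesis hf : orthonormal_basis f.
Hypothesis hS : forall n, S (f n) = f n.+1.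
Context {t : hilbert_tensor H H HH} (t3 : hilbert_tensor3 HHH t).

(** The intertwining relation determines u by its values on f_0 (x) H, and the
pentagon equation restricted to this first leg already contradicts unitarity. *)
Lemma no_multiplicative_unitary_shift (u : boundedOp HH) :
  multiplicative_unitary t3 u ->
  u * tensor_op t S 1 = tensor_op t S S * u -> False.
Proof.
move=> mu uS; have [[ul ur] _] := mu.
have uI z w : <[u z, u w]> = <[z, w]> by rewrite adjP -opME ul.
have f1 n : <[f n, f n]> = 1 by rewrite hf.1 eqxx.
have f0n n : <[f 0%N, f n.+1]> = 0 by rewrite hf.1.
(* u^* intertwines the adjoints of S (x) S and of S (x) 1, hence maps the
   kernel of the former into that of the latter. *)
have first_row z : tensor_op t (adj S) (adj S) z = 0 ->
    exists y, u (t (f 0%N) y) = z.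
  move=> z0; have [|y yP] := @ker_adj_shift_tens _ _ _ _ t f S (adj u z) hf hS.
    rewrite -Defs.adj1 -adj_tensor -opME -adjM uS adjM adj_tensor opME z0.
    exact: raddf0.
  by exists y; rewrite -yP -opME ur.
have [|s sP] := @choice _ _ (fun x y => u (t (f 0%N) y) = t (f 0%N) x).
  by move=> x; apply: first_row; rewrite tensor_opE (adj_shift0 hf hS) linear0l.
have [|g gP] := @choice _ _ (fun n y => u (t (f 0%N) y) = t (f n) (f 0%N)).
  by move=> n; apply: first_row; rewrite tensor_opE (adj_shift0 hf hS) linear0r.
have f0I x y : <[x, y]> = <[t (f 0%N) x, t (f 0%N) y]>.
  by rewrite inner_tens f1 mul1r.
have sI x y : <[s x, s y]> = <[x, y]> by rewrite f0I -uI !sP -f0I.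
have gg n : <[g n, g n]> = 1 by rewrite f0I -uI !gP inner_tens !f1 mulr1.
have sg x n : <[s x, g n.+1]> = 0.
  by rewrite f0I -uI sP gP inner_tens f0n mul0r.
(* The pentagon equation at f_0 (x) g_(n+1) (x) s x. *)
have ugs n x : u (t (g n.+1) (s x)) = t (g n.+1) (s x).
  apply: (pentagon_cancel t3 mu (basis_norm 0 hf) (gP n.+1)).
  rewrite (leg13E t3 (sP x)).
  by rewrite leg12E gP !tensA leg23E sP.
(* The pentagon equation at f_0 (x) g_1 (x) g_(n+1). *)
have ugg n : u (t (g 1%N) (g n.+1)) = t (s (f n)) (g 1%N).
  apply: (pentagon_cancel t3 mu (basis_norm 0 hf) (gP 1%N)).
  rewrite (leg13E t3 (gP 1%N)) leg12E tensA leg23E gP -tensA.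
  congr (tens_l t3 _ _).
  (* u (f_1 (x) s f_n) = (S (x) S) u (f_0 (x) s f_n) = f_1 (x) f_(n+1) *)
  have -> : t (f 1%N) (s (f n)) = tensor_op t S 1 (t (f 0%N) (s (f n))).
    by rewrite tensor_opE hS.
  by rewrite -opME uS opME sP tensor_opE !hS.
have f0g n : <[f 0%N, g n.+1]> = 0.
  apply/eqP; apply: contraT => /eqP c0.
  (* Otherwise s is the identity, but g_(n+1) is orthogonal to its range. *)
  suff : s (g n.+1) = g n.+1.
    move=> sgg; have := sg (g n.+1) n; rewrite sgg gg => /eqP.
    by rewrite oner_eq0.
  apply: inner_inj => z; apply: (mulfI (introN eqP c0)).
  by rewrite -(inner_tens t) -ugs -sP uI inner_tens sI.
have [j gj] : exists j, <[f j, g 1%N]> != 0.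
  apply: contrapT => no; have /eqP := gg 1%N.
  suff -> : g 1%N = 0 by rewrite inner0l eq_sym oner_eq0.
  apply: (basis_inj hf) => j; rewrite inner0l innerC.
  have [->|gj] := eqVneq <[f j, g 1%N]> 0; first exact: conjC0.
  by case: no; exists j.
have f0s n : <[f 0%N, s (f n)]> = 0.
  apply: (mulIf gj).
  by rewrite mul0r -(inner_tens t) -ugg -sP uI inner_tens f0g mul0r.
have uf0 : u (t (f 0%N) (f 0%N)) = 0.
  apply: (tens_basis_inj t hf hf) => -[|n] m; rewrite inner0l.
    by rewrite -(sP (f m)) uI inner_tens f0s mulr0.
  case: m => [|m]; first by rewrite -(gP n.+1) uI inner_tens f0g mulr0.
  (* f_(n+1) (x) f_(m+1) lies in the range of S (x) S = u (S (x) 1) u^*, and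
     the adjoint of S (x) 1 kills f_0 (x) f_0. *)
  rewrite -!hS -tensor_opE -[t (f n) (f m)]op1E -ur opME.
  rewrite -[tensor_op _ _ _ (u _)]opME -uS opME uI.
  by rewrite -[tensor_op t S 1]adjK -adjP adj_tensor tensor_opE (adj_shift0 hf hS)
             linear0l inner0l.
have /eqP := uI (t (f 0%N) (f 0%N)) (t (f 0%N) (f 0%N)).
by rewrite uf0 inner0l inner_tens !f1 mulr1 eq_sym oner_eq0.
Qed.

End NoMultiplicativeUnitary.

(** * The GNS representation of the Haar state *)

Section Vacuum.
Context {R : realType} {E : hilbertType R} {e : nat -> E} {T : boundedOp E}.
Hypothesis he : orthonormal_basis e.
Hypothesis hT : forall n, T (e n) = e n.+1.

Lemma cstar_generated_subalgebra {K : hilbertType R} (G : set (boundedOp K)) :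
  cstar_subalgebra (cstar_generated G).
Proof.
split=> [B cB _|k a b Aa Ab B cB GB|a b Aa Ab B cB GB|a Aa B cB GB|].
- exact: cstar0 cB.
- by apply: (cstar_linear cB); [exact: Aa|exact: Ab].
- by apply: (cstar_mul cB); [exact: Aa|exact: Ab].
- by apply: (cstar_adj cB); exact: Aa.
- move=> a Aa B cB GB; apply: (cstar_closed cB) => d d0.
  by have [b Ab ab] := Aa _ d0; exists b => //; exact: Ab.
Qed.

Notation A := (toeplitz_algebra T).

Let cA : cstar_subalgebra A. Proof. exact: cstar_generated_subalgebra. Qed.

Lemma toeplitz_gen : A T.
Proof. by move=> B _; exact. Qed.

Let A_adj : A (adj T). Proof. by apply: (cstar_adj cA); exact: toeplitz_gen. Qed.

Let A1 : A 1.
Proof.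
rewrite -(shift_isometry he hT).
by apply: (cstar_mul cA) => //; exact: toeplitz_gen.
Qed.

Let A_pow n : A (T ^+ n).
Proof.
elim: n => [|n IH]; first by rewrite expr0.
by rewrite exprS; apply: (cstar_mul cA) => //; exact: toeplitz_gen.
Qed.

Let pow_e0 n : (T ^+ n) (e 0%N) = e n.
Proof. by elim: n => [|n IH]; rewrite ?expr0// exprS opME IH hT. Qed.

Context {h : boundedOp E -> R[i]} {H : hilbertType R}.
Context {Lambda : boundedOp E -> H} {rho : boundedOp E -> boundedOp H}.
Hypothesis hh : state A h.
Hypothesis hTT : h (T * adj T) = 0.
Hypothesis hgns : gns_representation A h Lambda rho.

(** On the GNS space, a and its corner a P at e_0 represent the same vector,
because T^* represents zero; the state of P b^* a P is then read off from
[shift_defect] and h P = 1. *)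
Lemma gns_vacuum a b : A a -> A b ->
  <[Lambda a, Lambda b]> = <[a (e 0%N), b (e 0%N)]>.
Proof.
move=> Aa Ab; pose P := 1 - T * adj T.
have PE : P = (- 1) *: (T * adj T) + 1 by rewrite scaleN1r addrC.
have ATT : A (T * adj T) by apply: (cstar_mul cA) => //; exact: toeplitz_gen.
have AP : A P by rewrite PE; apply: (cstar_linear cA).
have hP : h P = 1.
  by rewrite PE (state_linear hh) // hTT (state1 hh) mulr0 add0r.
have hkP k : h (k *: P) = k.
  by rewrite -[k](subrK 1) scalerDl scale1r (state_linear hh)// hP mulr1.
have LT0 : Lambda (adj T) = 0.
  by apply/eqP; rewrite -inner_eq0 (gns_inner hgns)// adjK hTT.
have LP c : A c -> Lambda c = Lambda (c * P).
  move=> Ac.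
  have AcT : A (c * T) by apply: (cstar_mul cA) => //; exact: toeplitz_gen.
  have AcP : A (c * P) by apply: (cstar_mul cA).
  have {1}-> : c = 1 *: (c * T * adj T) + c * P.
    by rewrite scale1r mulrBr mulr1 mulrA addrC subrK.
  rewrite (gns_linear hgns)//; last by apply: (cstar_mul cA).
  by rewrite scale1r -(gns_mul hgns)// LT0 raddf0 add0r.
rewrite (LP a)// (LP b)// (gns_inner hgns); [|exact: (cstar_mul cA)..].
(* h (adj (b P) (a P)) = h (P b^* a P) *)
rewrite adjM adj_defect mulrA -[_ * adj b * a]mulrA (shift_defect he hT).
rewrite hkP opME.
by rewrite (adjP (adj b)) adjK.
Qed.

(** Totality is transported from the basis e: approximating a e_0 by the vectors
p e_0 with p a polynomial in T approximates Lambda a by Lambda p, since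
[gns_vacuum] makes a e_0 |-> Lambda a isometric. *)
Lemma vacuum_basis : orthonormal_basis (fun n => Lambda (T ^+ n)).
Proof.
split=> [m n|]; first by rewrite gns_vacuum// !pow_e0 he.1.
apply: dense_total_in => z d d0; have d20 : 0 < d / 2 by rewrite divr_gt0.
have : closure (Lambda @` A) z by rewrite (gns_dense hgns).
move=> /(_ _ (nbhsx_ballx z _ d20))[_ [[a Aa <-]]].
rewrite -ball_normE /ball_/= => /ltW za.
have [s as_] := total_inP (a (e 0%N)) he.2 d20.
exists s.
have [p [Ap <- pe]] : exists p, [/\ A p,
    Lambda p = \sum_(q <- s) q.1 *: Lambda (T ^+ q.2) &
    p (e 0%N) = \sum_(q <- s) q.1 *: e q.2].
  elim: (s) => [|q s' [p [Ap Lp pe]]].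
    exists 0; rewrite !big_nil; split=> //; first exact: (cstar0 cA).
    apply/eqP; rewrite -inner_eq0 gns_vacuum ?op0E ?inner0l//;
      exact: (cstar0 cA).
  exists (q.1 *: T ^+ q.2 + p); rewrite !big_cons; split.
  - exact: (cstar_linear cA).
  - by rewrite (gns_linear hgns)// Lp.
  - by rewrite opDE opZE pow_e0 pe.
rewrite -pe in as_.
rewrite -(subrK (Lambda a) z) -addrA (le_trans (ler_normD _ _))//.
rewrite (splitr d); apply: lerD => //; rewrite (le_trans _ as_)//.
have Aap : A (-1 *: p + a) by apply: (cstar_linear cA).
have LB : Lambda (- 1 *: p + a) = Lambda a - Lambda p.
  by rewrite (gns_linear hgns)// scaleN1r addrC.
rewrite le_eqVlt; apply/orP; left; rewrite -(@eqrXn2 _ 2%N)//.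
by rewrite -LB -!innerxx gns_vacuum// opDE opZE scaleN1r addrC.
Qed.

Lemma gns_shift n : rho T (Lambda (T ^+ n)) = Lambda (T ^+ n.+1).
Proof. by rewrite (gns_mul hgns) -?exprS//; exact: toeplitz_gen. Qed.

End Vacuum.

Theorem theorem3p2 (R : realType)
  (E EE : hilbertType R) (tE : hilbert_tensor E E EE)
  (e : nat -> E) (he : orthonormal_basis e)
  (T : boundedOp E) (hT : forall n, T (e n) = e n.+1)
  (Delta : boundedOp E -> boundedOp EE)
  (hDelta : unital_star_hom (toeplitz_algebra T)
     (min_tensor tE (toeplitz_algebra T) (toeplitz_algebra T)) Delta)
  (hDeltaT : Delta T = tensor_op tE T T)
  (h : boundedOp E -> R[i]) (hh : state (toeplitz_algebra T) h)
  (hhaar : forall n m : nat, (n, m) <> (0%N, 0%N) ->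
     h (T ^+ n * adj T ^+ m) = 0)
  (H HH HHH : hilbertType R) (t : hilbert_tensor H H HH)
  (t3 : hilbert_tensor3 HHH t)
  (Lambda : boundedOp E -> H) (pi : boundedOp E -> boundedOp H)
  (hgns : gns_representation (toeplitz_algebra T) h Lambda pi)
  (pipi : boundedOp EE -> boundedOp HH)
  (hpipi : unital_star_hom
     (min_tensor tE (toeplitz_algebra T) (toeplitz_algebra T)) setT pipi)
  (hpipiE : forall a b, toeplitz_algebra T a -> toeplitz_algebra T b ->
     pipi (tensor_op tE a b) = tensor_op t (pi a) (pi b)) :
  ~ exists u : boundedOp HH, multiplicative_unitary t3 u /\
      forall a, toeplitz_algebra T a ->
        pipi (Delta a) = u * tensor_op t (pi a) 1 * adj u.
Proof.
move=> [u [mu uDelta]].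
have AT : toeplitz_algebra T T by exact: toeplitz_gen.
have hTT : h (T * adj T) = 0 by have := hhaar 1%N 1%N; rewrite !expr1; exact.
apply: (no_multiplicative_unitary_shift (vacuum_basis he hT hh hTT hgns)
  (gns_shift he hT hgns) t3 u mu).
have [[ul _] _] := mu.
by rewrite -hpipiE// -hDeltaT uDelta// -mulrA ul mulr1.
Qed.
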